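(* Let $(X,\Sigma_X,\mu_X)$ and $(Y,\Sigma_Y,\mu_Y)$ be measure spaces, where $\Sigma_X$, $\Sigma_Y$ are semirings of subsets of $X$, $Y$ (in particular, they may be $\sigma$-algebras) and $\mu_X$, $\mu_Y$ are $\sigma$-additive measures. Then the set function $\mu_X\times\mu_Y$ is countably additive on the product semiring $\Sigma_X\otimes\Sigma_Y$ of subsets of $X\times Y$; that is, whenever $B,B_n\in\Sigma_X$ and $C,C_n\in\Sigma_Y$ ($n\in\mathbb N$) are such that the sets $B_n\times C_n$ are pairwise disjoint and $B\times C=\bigcup_{n\in\mathbb N}(B_n\times C_n)$, one has $$\mu_X(B)\,\mu_Y(C)=\sum_{n\in\mathbb N}\mu_X(B_n)\,\mu_Y(C_n).$$
   Context: A collection $\Sigma$ of subsets of a nonempty set $X$ is a semiring if (1) $\emptyset\in\Sigma$; (2) $A,B\in\Sigma$ implies $A\cap B\in\Sigma$; (3) for all $A,B\in\Sigma$ there exist pairwise disjoint $C_1,\dots,C_n\in\Sigma$ with $A\setminus B=\bigcup_{i=1}^n C_i$. A measure on a semiring $\Sigma$ is a function $\mu:\Sigma\to[0,\infty]$ with $\mu(\emptyset)=0$ such that $\mu(\bigcup_{n=1}^\infty A_n)=\sum_{n=1}^\infty\mu(A_n)$ for every pairwise disjoint sequence $(A_n)$ in $\Sigma$ whose union belongs to $\Sigma$ ($\sigma$-additivity). A measure space is a triplet $(X,\Sigma,\mu)$ with $\Sigma$ a semiring of subsets of $X$ and $\mu$ a measure on $\Sigma$. The product semiring is $\Sigma_X\otimes\Sigma_Y:=\{A\times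 B:A\in\Sigma_X,\ B\in\Sigma_Y\}$, and $\mu_X\times\mu_Y:\Sigma_X\otimes\Sigma_Y\to[0,\infty]$ is defined by $(\mu_X\times\mu_Y)(A\times B)=\mu_X(A)\cdot\mu_Y(B)$, with the convention $0\cdot\infty=0$. *)

(* Defs.v *)
From HB Require Import structures.
From mathcomp Require Import all_boot all_order all_algebra.
From mathcomp Require Import all_classical all_reals all_analysis.

Set Implicit Arguments.
Unset Strict Implicit.
Unset Printing Implicit Defensive.

Import Order.TTheory GRing.Theory Num.Theory.
Import numFieldNormedType.Exports.

Local Open Scope classical_set_scope.
Local Open Scope ring_scope.
Local Open Scope ereal_scope.

(* In the library a semiring of subsets of a nonempty set is a
   [semiRingOfSetsType d], the member sets being the [measurable] ones, and a
   [{measure set X -> \bar R}] on it is a [\bar R]-valued, nonnegative,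
   semi-sigma-additive function; its values outside the semiring are
   irrelevant. In [\bar R], [0 * +oo = 0]. *)

Section product_semiring.
Context (dX dY : measure_display).
Context (X : semiRingOfSetsType dX) (Y : semiRingOfSetsType dY).

Definition rectangles : set (set (X * Y)) :=
  [set A `*` B | A in measurable & B in measurable].

Lemma rectangles0 : rectangles set0.
Proof.
exists set0; first exact: measurable0.
by exists set0; [exact: measurable0|rewrite setX0].
Qed.

Lemma rectanglesI : setI_closed rectangles.
Proof.
move=> _ _ [A mA [B mB <-]] [A' mA' [B' mB' <-]].
exists (A `&` A'); first exact: measurableI.
by exists (B `&` B'); [exact: measurableI|rewrite setXI].
Qed.

Lemma rectanglesD : semi_setD_closed rectangles.
Proof.
move=> _ _ [A mA [B mB <-]] [A' mA' [B' mB' <-]].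
have [D [finD DM DE tD]] := semi_measurableD A A' mA mA'.
have [F [finF FM FE tF]] := semi_measurableD B B' mB mB'.
pose D1 := [set P `*` B | P in D].
pose F1 := [set (A `&` A') `*` Q | Q in F].
have DAA' P : D P -> P `<=` A `\` A' by move=> DP x Px; rewrite DE; exists P.
have FBB' Q : F Q -> Q `<=` B `\` B' by move=> FQ x Qx; rewrite FE; exists Q.
exists (D1 `|` F1); split.
- by rewrite finite_setU; split; exact: finite_image.
- move=> _ [[P DP <-]|[Q FQ <-]].
    by exists P; [exact: DM|exists B].
  by exists (A `&` A'); [exact: measurableI|exists Q; [exact: FM|]].
- apply/seteqP; split => [[x y] /= [[Ax By] nA'B']|[x y]].
    have [A'x|nA'x] := pselect (A' x).
      have : (B `\` B') y by split => // B'y; apply: nA'B'.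
      rewrite FE => -[Q FQ Qy].
      by exists ((A `&` A') `*` Q); [right; exists Q|].
    have : (A `\` A') x by [].
    rewrite DE => -[P DP Px].
    by exists (P `*` B); [left; exists P|].
  move=> [_ [[P DP <-]|[Q FQ <-]]] [/=].
    by move=> /(DAA' _ DP)[Ax nA'x] By; split => // -[].
  by move=> [Ax A'x] /(FBB' _ FQ)[By nB'y]; split => // -[].
- move=> _ _ [[P DP <-]|[Q FQ <-]] [[P' DP' <-]|[Q' FQ' <-]] [[x y] [[/=]]].
  + by move=> Px _ [/= P'x _]; rewrite (tD P P') //; exists x.
  + by move=> /(DAA' _ DP)[_ nA'x] _ [/= [_ A'x] _]; case: (nA'x A'x).
  + by move=> [_ A'x] _ [/= /(DAA' _ DP')[_ nA'x] _]; case: (nA'x A'x).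
  + by move=> _ Qy [/= _ Q'y]; rewrite (tF Q Q') //; exists y.
Qed.

(* A copy of the product type, whose semiring is that of the rectangles; the
   canonical structure on [X * Y] itself is the product sigma-algebra. *)
Definition rect_prod : Type := (X * Y)%type.

HB.instance Definition _ := Pointed.on rect_prod.

Definition rect_display : measure_display.
Proof. exact. Qed.

HB.instance Definition _ := isSemiRingOfSets.Build rect_display rect_prod
  rectangles0 rectanglesI rectanglesD.

Context (R : realType).
Context (muX : {measure set X -> \bar R}) (muY : {measure set Y -> \bar R}).

(* The value at a rectangle [A `*` B] is [muX A * muY B]; it does not depend on
   the choice of the sides, see [rect_measureE]. Sets that are not rectangles
   get a junk value. *)
Definition rect_measure (E : set rect_prod) : \bar R :=
  let AB := xget (set0, set0) [set AB : set X * set Y |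
    [/\ measurable AB.1, measurable AB.2 & AB.1 `*` AB.2 = E]] in
  muX AB.1 * muY AB.2.

Lemma rect_measureE (A : set X) (B : set Y) :
  measurable A -> measurable B -> rect_measure (A `*` B) = muX A * muY B.
Proof.
move=> mA mB; rewrite /rect_measure; case: xgetP => [[A' B'] _ /= [_ _ E]|].
  have [AB0|/set0P[[x y] [/= Ax By]]] := eqVneq (A `*` B) set0.
    have mu0 (S : set X) (T : set Y) : S `*` T = set0 -> muX S * muY T = 0.
      have [->|/set0P[x Sx]] := eqVneq S set0; first by rewrite measure0 mul0e.
      have [->|/set0P[y Ty]] := eqVneq T set0; first by rewrite measure0 mule0.
      by move=> ST0; have : (S `*` T) (x, y) by []; rewrite ST0.
    by rewrite !mu0 // E.
  have [A'x B'y] : (A' `*` B') (x, y) by rewrite E.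
  congr (muX _ * muY _).
    apply/seteqP; split => z Sz.
      by have [] : (A `*` B) (z, y) by rewrite -E.
    by have [] : (A' `*` B') (z, y) by rewrite E.
  apply/seteqP; split => z Sz.
    by have [] : (A `*` B) (x, z) by rewrite -E.
  by have [] : (A' `*` B') (x, z) by rewrite E.
by move=> /(_ (A, B))[].
Qed.

End product_semiring.

(* Main.v *)
(* Extend [muX] to a measure [nu] on the generated sigma-algebra. For fixed [x]
   the sections of the [B_ n `*` C_ n] at [x] partition the section of
   [B `*` C], so by sigma-additivity of [muY] the function giving the
   [muY]-measure of the section of [B `*` C] is the sum of the analogous
   functions for the [B_ n `*` C_ n]. Integrating term by term against [nu]
   gives the result; no sigma-finiteness is involved. *)
Require Import Defs.
From mathcomp Require Import all_boot all_order all_algebra.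
From mathcomp Require Import all_classical all_reals all_analysis.
From mathcomp Require Import measurable_realfun.

Local Open Scope classical_set_scope.
Local Open Scope ring_scope.
Local Open Scope ereal_scope.

Section rectangle_sections.
Context (R : realType) (dX dY : measure_display).
Context (X : semiRingOfSetsType dX) (Y : semiRingOfSetsType dY).
Context (muX : {measure set X -> \bar R}) (muY : {measure set Y -> \bar R}).

(** Integration needs a sigma-algebra, while [X] carries only a semiring; [I] is [X] with the
    generated one. *)
Let I := g_sigma_algebraType (@measurable _ X).

Let nu := measure_extension muX.

Let sub_salgebra (A : set X) : measurable A ->
  measurable (A : set I).
Proof. exact: sub_sigma_algebra. Qed.

(** Every section is [B] or empty, so it stays in the semiring of [Y]. *)
Lemma measurable_xsection_rectangle (A : set X) (B : set Y) (x : X) :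
  measurable B -> measurable (xsection (A `*` B) x).
Proof.
move=> mB; have [xA|xA] := boolP (x \in A); first by rewrite in_xsectionX.
by rewrite notin_xsectionX.
Qed.

Lemma measure_xsection_rectangle (A : set X) (B : set Y) :
  (fun x => muY (xsection (A `*` B) x)) = (cst (muY B)) \_ A.
Proof.
apply/funext => x; rewrite patchE; case: ifPn => xA.
  by rewrite in_xsectionX.
by rewrite notin_xsectionX// measure0.
Qed.

Lemma measurable_measure_xsection_rectangle (A : set X) (B : set Y) :
  measurable A ->
  measurable_fun [set: I]
    (fun x => muY (xsection (A `*` B) x)).
Proof.
move=> /sub_salgebra mA; rewrite measure_xsection_rectangle.
apply: (measurable_restrictT (cst (muY B) : I -> \bar R) mA).1.
exact: measurable_cst.
Qed.

(** The integrand is [muY B] on [A] and 0 elsewhere, and [nu] agrees with [muX] on the semiring.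
    Either factor may be infinite. *)
Lemma integral_measure_xsection_rectangle (A : set X) (B : set Y) :
  measurable A -> \int[nu]_x muY (xsection (A `*` B) x) = muX A * muY B.
Proof.
move=> mA; rewrite measure_xsection_rectangle -integral_mkcond.
rewrite (integral_cst _ (sub_salgebra _ mA)) muleC; congr (_ * _).
exact: measurable_mu_extE.
Qed.

Lemma measure_rectangle_bigcup (B : set X) (C : set Y)
    (B_ : nat -> set X) (C_ : nat -> set Y) :
  measurable B -> measurable C ->
  (forall n, measurable (B_ n)) -> (forall n, measurable (C_ n)) ->
  trivIset setT (fun n => B_ n `*` C_ n) ->
  B `*` C = \bigcup_n (B_ n `*` C_ n) ->
  muX B * muY C = \sum_(0 <= n <oo) muX (B_ n) * muY (C_ n).
Proof.
move=> mB mC mB_ mC_ tBC BCE.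
rewrite -integral_measure_xsection_rectangle//.
under eq_eseriesr do rewrite -integral_measure_xsection_rectangle//.
(* Monotone convergence: the terms are nonnegative and measurable, so sum and integral commute. *)
rewrite -integral_nneseries//; last first.
  by move=> n; exact: measurable_measure_xsection_rectangle.
apply: eq_integral => x _.
(* Additivity of [muY] requires the union of the sections to lie in the semiring; it does, being the
   section at [x] of the whole rectangle. *)
have mbigcup : measurable (\bigcup_n xsection (B_ n `*` C_ n) x).
  by rewrite -xsection_bigcup -BCE; exact: measurable_xsection_rectangle.
rewrite BCE xsection_bigcup measure_semi_bigcup//.
- by move=> n; exact: measurable_xsection_rectangle.
- exact: trivIset_xsection.
Qed.

Lemma rect_measure_semi_sigma_additive :
  semi_sigma_additive (rect_measure muX muY).
Proof.
move=> F mF tF [B mB [C mC BCE]].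
(* Membership in the product semiring only asserts that sides exist; choice fixes a pair of sides
   for each [n]. *)
have /choice[BC_ BC_P] n : exists S : set X * set Y,
    [/\ measurable S.1, measurable S.2 & S.1 `*` S.2 = F n].
  by have [S mS [T mT STE]] := mF n; exists (S, T).
have FE : F = fun n => (BC_ n).1 `*` (BC_ n).2.
  by apply/funext => n; have [_ _ ->] := BC_P n.
have mB_ n : measurable (BC_ n).1 by have [] := BC_P n.
have mC_ n : measurable (BC_ n).2 by have [] := BC_P n.
rewrite -BCE rect_measureE//.
rewrite (measure_rectangle_bigcup _ _ _ _ mB mC mB_ mC_); last 2 first.
- by rewrite -FE.
- by rewrite BCE FE.
rewrite FE; under eq_fun do under eq_bigr do rewrite rect_measureE//.
(* The expected limit is now the series itself, so only convergence of the partial sums is left, and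
   nonnegativity gives it. *)
by apply: is_cvg_nneseries => n _ _; exact: mule_ge0.
Qed.

End rectangle_sections.

Theorem corollary1 (R : realType) (dX dY : measure_display)
    (X : semiRingOfSetsType dX) (Y : semiRingOfSetsType dY)
    (muX : {measure set X -> \bar R}) (muY : {measure set Y -> \bar R}) :
  semi_sigma_additive (rect_measure muX muY) /\
  (forall (B : set X) (C : set Y) (B_ : nat -> set X) (C_ : nat -> set Y),
    measurable B -> measurable C ->
    (forall n, measurable (B_ n)) -> (forall n, measurable (C_ n)) ->
    trivIset setT (fun n => B_ n `*` C_ n) ->
    B `*` C = \bigcup_n (B_ n `*` C_ n) ->
    muX B * muY C = \sum_(0 <= n <oo) muX (B_ n) * muY (C_ n)).
Proof.
split; first exact: rect_measure_semi_sigma_additive.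
by move=> B C B_ C_; exact: measure_rectangle_bigcup.
Qed.
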